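(* Let $V\subset H$ be complex Hilbert spaces with $V$ densely and continuously embedded in $H$, and let $c>0$ with $\|x\|\le c\|x\|_V$ for $x\in V$. Let $a:V\times V\to\mathbb{C}$ be a sesquilinear form with constants $M,\gamma>0$ such that $$|a(x,y)|\le M\|x\|_V\|y\|_V,\qquad \operatorname{Re}a(x,x)\ge\gamma\|x\|_V^2,\qquad x,y\in V,$$ and let $A:\mathcal{D}(A)\subset H\to H$ be the operator associated with $a$. Let $(U_n)_{n\in\mathbb{N}}$ be a sequence of finite-dimensional subspaces of $V$ with $U_n\subset U_{n+1}$, let $A_n\in\mathcal{L}(U_n)$ be the operator associated with $a|_{U_n}$, i.e. $a(x,y)=\langle A_nx,y\rangle$ for $x,y\in U_n$, and let $P_n\in\mathcal{L}(H)$ be the orthogonal projection onto $U_n$. Let $W$ be a Hilbert space densely and continuously embedded into $H$ with $\mathcal{D}(A)\subset W\subset V$, and let $Q_n\in\mathcal{L}(W,V)$ be operators with range contained in $U_n$ and $\lim_{n\to\infty}\|I-Q_n\|_{\mathcal{L}(W,V)}=0$. Then for all $n\in\mathbb{N}$ $$\|I-P_n\|_{\mathcal{L}(W,H)}\le c\,\|I-Q_n\|_{\mathcal{L}(W,V)},$$ $$\|A^{-1}-A_n^{-1}P_n\|\le\frac{cM}{\gamma}\|A^{-1}\|_{\mathcal{L}(H,W)}\|I-Q_n\|_{\mathcal{L}(W,V)}.$$ In particular, the family $(P_n,A_n)_{n\in\mathbb{N}}$ approximates $A$ uniformly.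
   Context: $\mathcal{L}(X,Y)$ denotes the bounded linear operators from $X$ to $Y$, $\mathcal{L}(X)=\mathcal{L}(X,X)$; $\|\cdot\|$ and $\langle\cdot,\cdot\rangle$ without subscript refer to $H$ (and operators on $H$); $I$ denotes the identity, restricted to $W$ where appropriate (i.e. the embedding of $W$). The operator associated with $a$ is given by $\mathcal{D}(A)=\{x\in V: \exists c_x>0:\ |a(x,y)|\le c_x\|y\|\text{ for all }y\in V\}$ and $a(x,y)=\langle Ax,y\rangle$ for $x\in\mathcal{D}(A)$, $y\in V$. It is closed and densely defined with $0\in\varrho(A)$ and $\|A^{-1}\|\le c^2/\gamma$; likewise each $A_n$ is invertible with $\|A_n^{-1}\|\le c^2/\gamma$. By the closed graph theorem $A^{-1}\in\mathcal{L}(H,W)$. The family $(P_n,A_n)_{n\in\mathbb{N}}$ approximates $A$ uniformly (with respect to $W$) if: (i) $U_n\subset H$ are finite-dimensional subspaces; (ii) $P_n\in\mathcal{L}(H)$ are projections onto $U_n$ with $\sup_n\|P_n\|<\infty$ and $\|(I-P_n)|_W\|_{\mathcal{L}(W,H)}\to0$ as $n\to\infty$; (iii) $A_n\in\mathcal{L}(U_n)$ are invertible with $\|A^{-1}-A_n^{-1}P_n\|\to0$ as $n\to\infty$. (Condition (iii) implies that $A$ has compact resolvent.) *)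

(* Defs.v *)
From HB Require Import structures.
From mathcomp Require Import all_boot all_order all_algebra.
From mathcomp Require Import sesquilinear complex.
From mathcomp Require Import all_classical all_reals all_analysis.

Set Implicit Arguments.
Unset Strict Implicit.
Unset Printing Implicit Defensive.

Import Order.TTheory GRing.Theory Num.Theory.
Import numFieldNormedType.Exports.

Local Open Scope classical_set_scope.
Local Open Scope ring_scope.

(* The inner product is linear in its first argument and conjugate-linear in
   the second. *)
HB.mixin Record CompleteNormedModule_isHilbert (R : realType) (V : Type)
    of CompleteNormedModule R[i] V := {
  inner : {dot V for Num.conj} ;
  sqr_norm_inner : forall x : V, `|x| ^+ 2 = inner x x
}.

#[short(type="hilbertType")]
HB.structure Definition Hilbert (R : realType) :=
  {V of CompleteNormedModule_isHilbert R V & CompleteNormedModule R[i] V}.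

Section Operators.
Context {R : realType}.
Local Notation C := R[i].

(* The library norm of a complex normed space takes its (real) values in R[i];
   rnorm is the same norm with values in R. *)
Definition rnorm (V : normedZmodType C) (x : V) : R := complex.Re `|x|.

(* Extended-real valued, so that it is +oo on unbounded maps. *)
Definition opnorm (X Y : normedModType C) (f : X -> Y) : \bar R :=
  ereal_sup [set (rnorm (f x))%:E | x in [set x | rnorm x <= 1]].

Definition dense_embedding (X Y : normedModType C) (i : X -> Y) : Prop :=
  [/\ injective i, continuous i & dense (range i)].

Definition fin_dim_subspace (X : lmodType C) (U : set X) : Prop :=
  exists (d : nat) (b : 'I_d -> X),
    U = [set \sum_(k < d) u k *: b k | u in [set: 'I_d -> C]].

Definition projection_onto (X : normedModType C) (U : set X)
    (P : {linear X -> X}) : Prop :=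
  [/\ continuous P, range P = U & forall x, P (P x) = P x].

Definition orthogonal_projection_onto (H : hilbertType R) (U : set H)
    (P : {linear H -> H}) : Prop :=
  projection_onto U P /\ (forall x u, U u -> inner (x - P x) u = 0).

(* A linear operator with domain D is given by a total function, whose values
   outside of D are irrelevant. *)
Definition linear_on (X Y : lmodType C) (D : set X) (f : X -> Y) : Prop :=
  D 0 /\ (forall (k : C) x y, D x -> D y ->
    D (k *: x + y) /\ f (k *: x + y) = k *: f x + f y).

Definition bounded_operator_on (X : normedModType C) (U : set X) (f : X -> X) :
    Prop :=
  [/\ linear_on U f, (forall x, U x -> U (f x)) &
      exists K : R, forall x, U x -> rnorm (f x) <= K * rnorm x].

(* The inverse of f : D -> Y, extended by 0 outside of f @` D. *)
Definition inv_on (X Y : lmodType C) (D : set X) (f : X -> Y) : Y -> X :=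
  'pinv_(fun=> 0) D f.

(* 0 belongs to the resolvent set of the operator A with domain D. *)
Definition zero_in_resolvent (H : normedModType C) (D : set H) (A : H -> H) :
    Prop :=
  [/\ linear_on D A, set_bij D [set: H] A & (opnorm (inv_on D A) < +oo)%E].

(* The domain of the operator associated with the form a on V, where iV is the
   embedding of V into H. *)
Definition form_domain (H V : hilbertType R) (iV : V -> H)
    (a : V -> V -> C) : set H :=
  iV @` [set x | exists2 cx : R, 0 < cx &
                   forall y, rnorm (a x y) <= cx * rnorm (iV y)].

(* The family (P n, An n) approximates the operator A with domain D uniformly
   with respect to W, where iW is the embedding of W into H. The first
   condition is what gives a meaning to the inverse of A. *)
Definition approximates_uniformly (H W : hilbertType R) (iW : W -> H)
    (D : set H) (A : H -> H) (U : nat -> set H)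
    (P : nat -> {linear H -> H}) (An : nat -> H -> H) : Prop :=
  [/\ zero_in_resolvent D A,
      forall n, fin_dim_subspace (U n),
      [/\ forall n, projection_onto (U n) (P n),
          (ereal_sup (range (fun n => opnorm (P n))) < +oo)%E &
          opnorm (fun w : W => iW w - P n (iW w)) @[n --> \oo] --> 0%E] &
      (forall n, bounded_operator_on (U n) (An n) /\
                 set_bij (U n) (U n) (An n)) /\
      opnorm (fun z : H => inv_on D A z - inv_on (U n) (An n) (P n z))
        @[n --> \oo] --> 0%E].

End Operators.

(* Main.v *)
(** By Lax-Milgram, [x = A^-1 z] is the unique element of [V] with
    [a x v = <z, v>] for all [v], and [x_n = A_n^-1 P_n z] is the element of
    [U_n] with the same property for [v] in [U_n]; hence [a (x - x_n) v = 0] on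
    [U_n], and coercivity gives Cea's estimate
    [gamma |x - x_n|_V <= M |x - Q_n x|_V]. The estimate for [P_n] holds because
    [P_n w] is the best approximation of [w] in [U_n]. For the convergence one
    also needs [A^-1] to be bounded from [H] to [W]: the functionals
    [z |-> <A^-1 z, h>], with [h] such that the adjoint of the embedding of [W]
    maps it into the unit ball, are pointwise bounded on [H], hence uniformly
    bounded. *)

Require Import Defs.
From HB Require Import structures.
From mathcomp Require Import all_boot all_order all_algebra.
From mathcomp Require Import sesquilinear complex ring lra.
From mathcomp Require Import all_classical all_reals all_analysis.

Set Implicit Arguments.
Unset Strict Implicit.
Unset Printing Implicit Defensive.

Import Order.TTheory GRing.Theory Num.Theory.
Import numFieldNormedType.Exports.

Local Open Scope classical_set_scope.
Local Open Scope ring_scope.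

(** * Real-valued norms and inner products *)

Section RealNorm.
Context {R : realType}.
Local Notation C := R[i].

Lemma ReD (x y : C) : complex.Re (x + y) = complex.Re x + complex.Re y.
Proof. by case: x; case: y. Qed.

Section NormedZmod.
Variable V : normedZmodType C.
Implicit Types x y : V.

Lemma normrE x : `|x| = (rnorm x)%:C%C.
Proof. by rewrite /rnorm RRe_real// ger0_real. Qed.

Lemma rnorm_ge0 x : 0 <= rnorm x.
Proof. by rewrite -ler0c -normrE. Qed.

Lemma rnorm0 : rnorm (0 : V) = 0.
Proof. by rewrite /rnorm normr0. Qed.

Lemma rnorm_eq0 x : (rnorm x == 0) = (x == 0).
Proof.
by rewrite -[RHS]normr_eq0 normrE -(rmorph0 (real_complex R))
  (inj_eq (@complexI _)).
Qed.

Lemma rnormN x : rnorm (- x) = rnorm x.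
Proof. by rewrite /rnorm normrN. Qed.

Lemma rnormBC x y : rnorm (x - y) = rnorm (y - x).
Proof. by rewrite /rnorm distrC. Qed.

Lemma ler_rnormD x y : rnorm (x + y) <= rnorm x + rnorm y.
Proof. by rewrite -lecR rmorphD/= -!normrE ler_normD. Qed.

Lemma ler_rnormB x y : rnorm (x - y) <= rnorm x + rnorm y.
Proof. by rewrite (le_trans (ler_rnormD _ _))// rnormN. Qed.

End NormedZmod.

Lemma rnormZ (V : normedModType C) (k : C) (x : V) :
  rnorm (k *: x) = rnorm k * rnorm x.
Proof. by apply: (@complexI R); rewrite rmorphM/= -!normrE normrZ. Qed.

Lemma rnormM (k l : C) : rnorm (k * l) = rnorm k * rnorm l.
Proof. by apply: (@complexI R); rewrite rmorphM/= -!normrE normrM. Qed.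

Lemma rnorm_conj (z : C) : rnorm z^* = rnorm z.
Proof. by rewrite /rnorm norm_conjC. Qed.

Lemma rnorm_real (r : R) : rnorm (r%:C%C : C) = `|r|.
Proof. by rewrite /rnorm normc_def/= expr0n addr0 sqrtr_sqr. Qed.

Lemma Re_le_rnorm (z : C) : complex.Re z <= rnorm z.
Proof.
by rewrite (le_trans (ler_norm _))// -lecR -normrE normc_ge_Re.
Qed.

End RealNorm.

Section InnerProduct.
Context {R : realType} {V : hilbertType R}.
Local Notation C := R[i].
Implicit Types x y z : V.

Lemma innerC x y : inner x y = (inner y x)^*.
Proof. by rewrite hermC expr0 mul1r. Qed.

Lemma innerDl x y z : inner (x + y) z = inner x z + inner y z.
Proof. exact: linearDl. Qed.

Lemma innerBl x y z : inner (x - y) z = inner x z - inner y z.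
Proof. exact: linearBl. Qed.

Lemma innerDr x y z : inner z (x + y) = inner z x + inner z y.
Proof. exact: linearDr. Qed.

Lemma innerBr x y z : inner z (x - y) = inner z x - inner z y.
Proof. exact: linearBr. Qed.

Lemma innerZl (k : C) x y : inner (k *: x) y = k * inner x y.
Proof. exact: linearZl_LR. Qed.

Lemma innerZr (k : C) x y : inner x (k *: y) = k^* * inner x y.
Proof. by rewrite linearZr_LR. Qed.

Lemma inner0l x : inner 0 x = 0.
Proof. exact: linear0l. Qed.

Lemma inner0r x : inner x 0 = 0.
Proof. exact: linear0r. Qed.

Lemma inner_eq0C x y : inner x y = 0 -> inner y x = 0.
Proof. by rewrite innerC => /eqP; rewrite conjC_eq0 => /eqP. Qed.

Lemma innerxx x : inner x x = (rnorm x ^+ 2)%:C%C.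
Proof. by rewrite -sqr_norm_inner normrE rmorphXn. Qed.

Lemma Re_innerxx x : complex.Re (inner x x) = rnorm x ^+ 2.
Proof. by rewrite innerxx. Qed.

Lemma innerxx_eq0 x : inner x x = 0 -> x = 0.
Proof.
by rewrite -sqr_norm_inner => /eqP; rewrite expf_eq0/= normr_eq0 => /eqP.
Qed.

Lemma rnormD_orthogonal x y : inner x y = 0 ->
  rnorm (x + y) ^+ 2 = rnorm x ^+ 2 + rnorm y ^+ 2.
Proof.
move=> xy; rewrite -!Re_innerxx innerDl !innerDr xy (inner_eq0C xy).
by rewrite addr0 add0r ReD.
Qed.

Lemma parallelogram x y : rnorm (x + y) ^+ 2 + rnorm (x - y) ^+ 2 =
  2 * (rnorm x ^+ 2 + rnorm y ^+ 2).
Proof.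
rewrite -!Re_innerxx mulrDl mul1r -!ReD; congr (complex.Re _).
rewrite innerDl innerBl !innerBr !innerDr; ring.
Qed.

Lemma inner_proj_line x u : u != 0 ->
  inner (x - (inner x u / inner u u) *: u) u = 0.
Proof.
move=> u0; rewrite innerBl innerZl divfK ?subrr//.
by apply: contra_neq u0 => /innerxx_eq0.
Qed.

(** Pythagoras for the residual of [x] and its component along [u]. Dropping the residual gives
    Cauchy-Schwarz; if subtracting the component does not shorten [x], that component must
    vanish. *)
Lemma rnorm_sub_proj_line x u : u != 0 ->
  rnorm x ^+ 2 = rnorm (x - (inner x u / inner u u) *: u) ^+ 2 +
                 (rnorm (inner x u) / rnorm u) ^+ 2.
Proof.
move=> u0; set k := inner x u / inner u u; rewrite -{1}(subrK (k *: u) x).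
rewrite [LHS]rnormD_orthogonal; last by rewrite innerZr inner_proj_line// mulr0.
congr (_ + _ ^+ 2); have ru0 : rnorm u != 0 by rewrite rnorm_eq0.
apply/(mulIf ru0); rewrite divfK// rnormZ -mulrA -[rnorm u * _]expr2.
have -> : rnorm u ^+ 2 = rnorm (inner u u).
  by rewrite innerxx rnorm_real ger0_norm// sqr_ge0.
by rewrite -rnormM divfK//; apply: contra_neq u0 => /innerxx_eq0.
Qed.

Lemma rnorm_inner_le x y : rnorm (inner x y) <= rnorm x * rnorm y.
Proof.
have [->|y0] := eqVneq y 0; first by rewrite inner0r !rnorm0 mulr0.
have yn : 0 < rnorm y by rewrite lt_neqAle rnorm_ge0 eq_sym rnorm_eq0 y0.
rewrite -ler_pdivrMr// -ler_sqr ?nnegrE ?divr_ge0 ?rnorm_ge0//.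
by rewrite [leRHS](rnorm_sub_proj_line _ y0) lerDr sqr_ge0.
Qed.

Lemma inner_all0 (x : V) : (forall y, inner x y = 0) -> x = 0.
Proof. by move=> /(_ x)/innerxx_eq0. Qed.

End InnerProduct.

(** * Completeness and uniform boundedness *)

Section Topology.
Context {R : realType}.
Local Notation C := R[i].

(** A positive element of [R[i]] is real, so the complex radii of balls can be traded for radii in
    [R]. *)
Lemma gt0_complexE (z : C) : 0 < z -> 0 < complex.Re z /\ z = (complex.Re z)%:C%C.
Proof.
move=> z0; have zE : z = (complex.Re z)%:C%C by rewrite RRe_real// gtr0_real.
by split=> //; move: z0; rewrite zE -(rmorph0 (real_complex R)) ltcR.
Qed.

Lemma nbhs_rnormP (V : normedModType C) (x : V) (A : set V) :
  nbhs x A <-> exists2 e : R, 0 < e & forall y, rnorm (x - y) < e -> A y.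
Proof.
rewrite -nbhs_nbhs_norm; split=> -[e /= e0 eA].
- have [re0 eE] := gt0_complexE e0.
  by exists (complex.Re e) => // y xy; apply: eA; rewrite /= eE normrE ltcR.
- exists e%:C%C; first by rewrite /= -(rmorph0 (real_complex R)) ltcR.
  by move=> y; rewrite /= normrE ltcR; exact: eA.
Qed.

Lemma closure_rnormP (V : normedModType C) (x : V) (A : set V) :
  closure A x <-> forall e : R, 0 < e -> exists2 y, A y & rnorm (x - y) < e.
Proof.
split=> [clA e e0|clA B /nbhs_rnormP[e e0 eB]].
  have /clA[y [Ay xy]] : nbhs x [set y | rnorm (x - y) < e].
    by apply/nbhs_rnormP; exists e.
  by exists y.
by have [y Ay /eB By] := clA _ e0; exists y.
Qed.

Lemma rnorm_complete (V : completeNormedModType C) (u : nat -> V) :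
  (forall e : R, 0 < e ->
     exists N, forall m n, (N <= m)%N -> (N <= n)%N -> rnorm (u m - u n) < e) ->
  exists l, forall e : R, 0 < e ->
     exists N, forall n, (N <= n)%N -> rnorm (l - u n) < e.
Proof.
move=> cu; have : cvg (u @ \oo).
  apply/cauchy_cvgP/cauchy_exP => e /gt0_complexE[re0 eE].
  have [N uN] := cu _ re0; exists (u N); exists N => // n /= Nn.
  by rewrite -ball_normE /ball_/= eE normrE ltcR; exact: uN.
move=> /cvg_ex[l ul]; exists l => e e0.
have /ul : nbhs l [set y | rnorm (l - y) < e] by apply/nbhs_rnormP; exists e.
by move=> [N _ uN]; exists N => n /uN.
Qed.

Lemma continuous_rnorm_le (V W : normedModType C) (f : {linear V -> W}) :
  continuous f -> exists2 K : R, 0 < K & forall x, rnorm (f x) <= K * rnorm x.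
Proof.
move=> /linear_bounded_continuous/linear_boundedP.
move=> /pinfty_ex_gt0[K /gt0_complexE[K0 KE] fK].
exists (complex.Re K) => // x.
by rewrite -lecR rmorphM/= -!normrE -KE.
Qed.

Lemma ex_invS_lt (e : R) : 0 < e -> exists N, N.+1%:R^-1 < e.
Proof. by move=> /ltr_add_invr[N]; rewrite add0r; exists N. Qed.

End Topology.

(** * The uniform boundedness principle for seminorms *)

Section UniformBoundedness.
Context {R : realType} {V : completeNormedModType R[i]}.
Local Notation C := R[i].

(* Gliding hump: one of the two points x + y and x - y is at least as large
   as y under a seminorm, and a seminorm large at a point stays large nearby. *)
Lemma seminorms_uniformly_bounded (F : set (V -> R)) :
  (forall p, F p -> [/\ (forall x y, p (x + y) <= p x + p y),
     (forall (r : R) x, p (r%:C%C *: x) = `|r| * p x) &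
     exists K, forall x, p x <= K * rnorm x]) ->
  (forall x, exists B, forall p, F p -> p x <= B) ->
  exists2 K, 0 < K & forall p x, F p -> p x <= K * rnorm x.
Proof.
move=> Fsemi Fpt; apply: contrapT => Funb.
have big K : 0 < K -> exists2 p, F p & exists2 y, rnorm y <= 1 & K < p y.
  move=> K0; apply: contrapT => Kub; apply: Funb; exists K => // p x Fp.
  rewrite leNgt; apply/negP => Kpx; apply: Kub; exists p => //.
  have [_ pZ [L pL]] := Fsemi _ Fp.
  have x0 : 0 < rnorm x.
    rewrite lt_neqAle rnorm_ge0 andbT eq_sym; apply/eqP => x0.
    by have := pL x; rewrite leNgt x0 mulr0 -(mulr0 K) -{1}x0 Kpx.
  exists ((rnorm x)^-1%:C%C *: x).
    by rewrite rnormZ rnorm_real gtr0_norm ?invr_gt0// mulVf// gt_eqF.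
  by rewrite pZ gtr0_norm ?invr_gt0// mulrC ltr_pdivlMr.
(* A state is a stage [n] with a ball of centre [x] and radius [r]. The next ball lies inside it,
   has at most half its radius, and some seminorm of [F] is at least [n] on all of it. *)
have /choice[f fP] : forall s : nat * (V * R), exists t : V * R,
    0 < s.2.2 -> [/\ 0 < t.2, t.2 <= s.2.2 / 2, rnorm (s.2.1 - t.1) + t.2 <= s.2.2 &
      forall z, rnorm (t.1 - z) <= t.2 -> exists2 p, F p & s.1%:R <= p z].
  move=> [n [x r]] /=; have [r0|] := ltP 0 r; last by exists (x, r).
  have r20 : 0 < r / 2 by rewrite divr_gt0.
  (* Scaled by [r / 2], the vector [y] still has seminorm above [n.+1]; the extra unit pays for the
     variation of [p] over the new ball. *)
  have [|p Fp [y y1 py]] := big ((n.+1)%:R / (r / 2)); first by rewrite divr_gt0.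
  have [pD pZ [L pL]] := Fsemi _ Fp.
  have pN v : p (- v) = p v.
    by rewrite -scaleN1r -[RHS]mul1r -(normrN1 R) -pZ rmorphN1.
  pose w := (r / 2)%:C%C *: y.
  have pw : n.+1%:R < p w.
    by rewrite pZ gtr0_norm// mulrC -ltr_pdivrMr.
  have wr : rnorm w <= r / 2.
    by rewrite rnormZ rnorm_real gtr0_norm// ler_piMr// ltW.
  have [x' x'x px'] : exists2 x', rnorm (x - x') = rnorm w & p w <= p x'.
    have [h|h] := leP (p w) (p (x + w)).
      by exists (x + w) => //; rewrite opprD addNKr rnormN.
    exists (x - w); first by rewrite opprB addrC subrK.
    have := pD (x + w) (w - x); rewrite -[w - x]opprB pN.
    have -> : x + w - (x - w) = (2 : R)%:C%C *: w.
      by rewrite opprB addrC addrA subrK rmorph_nat scaler_nat mulr2n.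
    rewrite pZ gtr0_norm//; move: h; clear; lra.
  (* A radius of at most [L'^-1] lets [p] vary by at most 1. *)
  pose L' := `|L| + 1; have L'0 : 0 < L' by rewrite ltr_wpDl.
  exists (x', Num.min (r / 2) L'^-1) => _ /=; split.
  - by rewrite lt_min r20 invr_gt0.
  - by rewrite ge_min lexx.
  - rewrite x'x [leRHS](splitr r) lerD// ge_min lexx//.
  - move=> z; rewrite le_min => /andP[_ x'z]; exists p => //.
    have Lz : L * rnorm (x' - z) <= 1.
      apply: (@le_trans _ _ (L' * rnorm (x' - z))).
        by rewrite ler_wpM2r ?rnorm_ge0// (le_trans (ler_norm _))// lerDl.
      by rewrite mulrC -ler_pdivlMr// mul1r.
    have := pD (x' - z) z; rewrite subrK.
    move: (pL (x' - z)) Lz pw px'; rewrite -natr1; lra.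
(* Nested balls, starting from the unit ball at 0. Since radii at least halve and
   [n + 2 <= 2 * (n + 1)], they stay below [n.+1%:R^-1], and the centres form a Cauchy sequence. *)
pose s := fix s n : V * R := if n is n'.+1 then f (n', s n') else (0, 1).
have s0 n : 0 < (s n).2 by elim: n => //= n IH; case: (fP (n, s n) IH).
have sle n : (s n).2 <= n.+1%:R^-1.
  elim: n => [|n IH] /=; first by rewrite invr1.
  have [_ h _ _] := fP (n, s n) (s0 n); rewrite (le_trans h)//=.
  rewrite (le_trans (ler_wpM2r _ IH))// -invfM lef_pV2 ?posrE//.
  by rewrite -natrM ler_nat muln2 -addnn addSn ltnS leq_addl.
have sball m n : (n <= m)%N -> rnorm ((s n).1 - (s m).1) + (s m).2 <= (s n).2.
  elim: m => [|m IH]; first by rewrite leqn0 => /eqP->; rewrite subrr rnorm0 add0r.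
  rewrite leq_eqVlt => /predU1P[->|]; first by rewrite subrr rnorm0 add0r.
  rewrite ltnS => /IH; have [_ _ /= + _] := fP (m, s m) (s0 m).
  have := ler_rnormD ((s n).1 - (s m).1) ((s m).1 - (s m.+1).1).
  rewrite addrA subrK /=; lra.
have [e e0|l sl] := @rnorm_complete _ V (fun n => (s n).1).
  have [N Ne] : exists N, N.+1%:R^-1 < e / 2 by apply: ex_invS_lt; rewrite divr_gt0.
  exists N => m n Nm Nn; have := sball _ _ Nm; have := sball _ _ Nn.
  have := ler_rnormD ((s m).1 - (s N).1) ((s N).1 - (s n).1).
  rewrite addrA subrK [X in _ <= X + _ -> _]rnormBC.
  move: (s0 m) (s0 n) (le_lt_trans (sle N) Ne); lra.
have lball n : rnorm ((s n).1 - l) <= (s n).2.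
  apply/ler_addgt0Pr => e /sl[N Ne].
  have := Ne _ (leq_maxl N n); have := sball _ _ (leq_maxr N n).
  have := ler_rnormD ((s n).1 - (s (maxn N n)).1) ((s (maxn N n)).1 - l).
  rewrite addrA subrK [X in _ <= _ + X -> _]rnormBC.
  move: (s0 (maxn N n)); lra.
have [B FB] := Fpt l.
(* The limit [l] lies in every ball. On the ball of index [m.+1] some seminorm is at least [m],
   which exceeds the pointwise bound [B] at [l]. *)
pose m := (Num.truncn B).+1; have [_ _ _ h] := fP (m, s m) (s0 m).
have [p Fp] := h l (lball m.+1).
rewrite /=; have := FB _ Fp; have := truncnS_gt B; rewrite -/m; lra.
Qed.

End UniformBoundedness.

(** * Orthogonal projection, Riesz and Lax-Milgram *)

Section LaxMilgram.
Context {R : realType}.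
Local Notation C := R[i].

Definition subspace (V : lmodType C) (S : set V) : Prop :=
  S 0 /\ forall (k : C) x y, S x -> S y -> S (k *: x + y).

Lemma subspaceZ (V : lmodType C) (S : set V) (k : C) x :
  subspace S -> S x -> S (k *: x).
Proof. by move=> [S0 SL] Sx; rewrite -[_ *: _]addr0; exact: SL. Qed.

Lemma subspaceD (V : lmodType C) (S : set V) x y :
  subspace S -> S x -> S y -> S (x + y).
Proof. by move=> [S0 SL] Sx Sy; rewrite -[x]scale1r; exact: SL. Qed.

Lemma subspaceB (V : lmodType C) (S : set V) x y :
  subspace S -> S x -> S y -> S (x - y).
Proof. by move=> [S0 SL] Sx Sy; rewrite addrC -scaleN1r; exact: SL. Qed.

Variable V : hilbertType R.
Implicit Types (x y : V) (S : set V).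

(** Antilinear because the functionals [a x] and [inner g] act through the second, conjugate-linear
    argument. *)
Definition bounded_antilinear (f : V -> C) : Prop :=
  (forall (k : C) x y, f (k *: x + y) = k^* * f x + f y) /\
  exists K : R, forall x, rnorm (f x) <= K * rnorm x.

(** By the parallelogram law a sequence in [S] minimising the distance to [x] is Cauchy. For an
    arbitrary subspace its limit lies in the closure, and in this form the lemma also serves to
    prove density. *)
Lemma closure_orthogonal_decomposition S x : subspace S ->
  exists2 p, closure S p & forall u, S u -> inner (x - p) u = 0.
Proof.
move=> subS; have [S0 SL] := subS.
pose E := [set rnorm (x - s) | s in S]; pose d := inf E.
have Einf : has_inf E.
  split; first by exists (rnorm (x - 0)), 0.
  by exists 0 => _ [s _ <-]; exact: rnorm_ge0.
have dle s : S s -> d <= rnorm (x - s).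
  by move=> Ss; apply: ge_inf; [exact: Einf.2|exists s].
have d0 : 0 <= d by apply: lb_le_inf => [|_ [s _ <-]]; [exact: Einf.1|exact: rnorm_ge0].
have /choice[s sP] (n : nat) : exists s, S s /\ rnorm (x - s) < d + n.+1%:R^-1.
  have [|_ [s Ss <-] sd] := inf_adherent (_ : 0 < n.+1%:R^-1) Einf; last by exists s.
  by rewrite invr_gt0.
have [e e0|p ps] := @rnorm_complete _ V s.
  (* With [t] equal to [N.+1%:R^-1] the parallelogram law bounds the squared distance of two late
     terms by [4 * (d + t) ^+ 2 - 4 * d ^+ 2], which is at most [t * (8 * d + 4)] as [t <= 1]. *)
  have d8 : 0 < 8 * d + 4 by rewrite ltr_wpDl// mulr_ge0.
  have [N Ne] : exists N, N.+1%:R^-1 < e ^+ 2 / (8 * d + 4).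
    by apply: ex_invS_lt; rewrite divr_gt0// exprn_gt0.
  exists N => m n Nm Nn; set t := N.+1%:R^-1 in Ne.
  have t0 : 0 < t by rewrite invr_gt0.
  have t1 : t <= 1 by rewrite invf_le1// ler1n.
  have st k : (N <= k)%N -> rnorm (x - s k) < d + t.
    move=> Nk; rewrite (lt_le_trans (sP k).2)// lerD2l lef_pV2 ?posrE//.
    by rewrite ler_nat ltnS.
  have mid : 2 * d <= rnorm ((x - s m) + (x - s n)).
    have -> : (x - s m) + (x - s n) =
        (2 : R)%:C%C *: (x - (2^-1 : R)%:C%C *: (s m + s n)).
      rewrite scalerBr scalerA -rmorphM divff// rmorph1 scale1r.
      by rewrite rmorph_nat scaler_nat mulr2n opprD addrACA.
    rewrite rnormZ rnorm_real gtr0_norm// ler_wpM2l// dle//.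
    by apply: subspaceZ => //; apply: subspaceD => //; apply: (sP _).1.
  have := parallelogram (x - s m) (x - s n).
  have -> : x - s m - (x - s n) = - (s m - s n).
    by rewrite !opprB addrC addrA subrK.
  rewrite rnormN => para; rewrite -ltr_sqr ?nnegrE ?rnorm_ge0 ?ltW//.
  have sq k : (N <= k)%N -> rnorm (x - s k) ^+ 2 <= (d + t) ^+ 2.
    move=> Nk; rewrite ler_sqr ?nnegrE ?rnorm_ge0 ?addr_ge0// ?ltW//.
    exact: st.
  have mid2 : (2 * d) ^+ 2 <= rnorm (x - s m + (x - s n)) ^+ 2.
    by rewrite ler_sqr ?nnegrE ?rnorm_ge0// mulr_ge0.
  have te : t * (8 * d + 4) < e ^+ 2 by rewrite -ltr_pdivlMr.
  have tt : t ^+ 2 <= t by rewrite expr2 ler_piMl// ltW.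
  move: (sq _ Nm) (sq _ Nn) para mid2 te tt; lra.
have clp : closure S p.
  apply/closure_rnormP => e /ps[N /(_ N (leqnn N)) pN].
  by exists (s N) => //; exact: (sP N).1.
exists p => // u Su; have [->|u0] := eqVneq u 0; first by rewrite inner0r.
have xpd : rnorm (x - p) <= d.
  apply/ler_addgt0Pr => e e0; have e20 : 0 < e / 2 by rewrite divr_gt0.
  have [N1 N1e] := ex_invS_lt e20; have [N2 N2e] := ps _ e20.
  have pN := N2e _ (leq_maxr N1 N2); set N := maxn N1 N2 in pN.
  have xN : rnorm (x - s N) < d + e / 2.
    rewrite (lt_le_trans (sP N).2)// lerD2l (le_trans _ (ltW N1e))//.
    by rewrite lef_pV2 ?posrE// ler_nat ltnS leq_maxl.
  have := ler_rnormD (x - s N) (s N - p).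
  rewrite addrA subrK [rnorm (s N - p)]rnormBC => /le_trans; apply.
  by rewrite [leRHS](_ : _ = d + e / 2 + e / 2) ?lerD// ?ltW// -addrA -splitr.
have dxp v : S v -> d <= rnorm (x - p - v).
  move=> Sv; apply/ler_addgt0Pr => e /ps[N /(_ N (leqnn N)) pN].
  have := dle (s N + v) (subspaceD subS (sP N).1 Sv).
  have := ler_rnormD (x - p - v) (p - s N).
  have -> : x - p - v + (p - s N) = x - (s N + v).
    by rewrite addrAC addrA subrK opprD addrA.
  lra.
(* No multiple of [u] subtracted from [x - p] shortens it, so in Pythagoras the component along [u]
   has to be 0. *)
have := rnorm_sub_proj_line (x - p) u0.
have /(_ (inner (x - p) u / inner u u)) h k : rnorm (x - p) <= rnorm (x - p - k *: u).
  by rewrite (le_trans xpd)// dxp//; exact: subspaceZ.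
have := sqr_ge0 (rnorm (inner (x - p) u) / rnorm u).
move: h; rewrite -ler_sqr ?nnegrE ?rnorm_ge0// => h1 h2 h3.
have /eqP : (rnorm (inner (x - p) u) / rnorm u) ^+ 2 = 0 by move: h1 h2 h3; lra.
by rewrite sqrf_eq0 mulf_eq0 invr_eq0 !rnorm_eq0 (negbTE u0) orbF => /eqP.
Qed.

(** Off its kernel [f] has one direction left: a vector [z] orthogonal to the kernel, scaled to give
    [f z] the right value, represents [f]. Boundedness makes the kernel closed, which keeps [z] out
    of it. *)
Lemma riesz_representation (f : V -> C) : bounded_antilinear f ->
  exists g, forall v, f v = inner g v.
Proof.
move=> [fL [K fK]].
have [f0|/existsNP[x /eqP fx]] := pselect (forall v, f v = 0).
  by exists 0 => v; rewrite f0 inner0l.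
have fB u v : f (u - v) = f u - f v.
  by rewrite addrC -scaleN1r fL rmorphN1 mulN1r addrC.
have f0 : f 0 = 0 by rewrite -(subrr 0) fB subrr.
have [|p clp xp] := @closure_orthogonal_decomposition [set v | f v = 0] x.
  by split => //= k u v fu fv; rewrite fL fu fv mulr0 addr0.
have fp : f p = 0.
  apply/eqP; rewrite -rnorm_eq0 eq_le rnorm_ge0 andbT; apply/ler_addgt0Pr => e e0.
  have K0 : 0 < `|K| + 1 by rewrite ltr_wpDl.
  move/closure_rnormP : clp => /(_ (e / (`|K| + 1))); rewrite divr_gt0//.
  move=> /(_ isT)[y /= fy py]; rewrite add0r -[f p]subr0 -fy -fB (le_trans (fK _))//.
  rewrite (@le_trans _ _ ((`|K| + 1) * rnorm (p - y)))//.
    by rewrite ler_wpM2r ?rnorm_ge0// (le_trans (ler_norm _))// lerDl.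
  by rewrite mulrC -ler_pdivlMr// ltW.
pose z := x - p; have fz : f z = f x by rewrite fB fp subr0.
have zz : inner z z != 0.
  by apply: contra_neq fx => /innerxx_eq0 z0; rewrite -fz z0.
exists ((f z / inner z z) *: z) => v.
(* The conjugate cancels the one produced by antilinearity, so this difference lies in the kernel of
   [f]. *)
have : inner z (v - (f v / f z)^* *: z) = 0.
  by apply: xp; rewrite /= addrC -scaleNr fL rmorphN/= conjCK mulNr divfK ?fz// addNr.
rewrite innerBr innerZr conjCK => /subr0_eq zv.
by rewrite innerZl zv; field; rewrite zz fz fx.
Qed.

(** * Coercive forms and the Lax-Milgram theorem *)

Section Form.
Variables (a : {bilinear V -> V -> C | *%R & (Num.conj \; *%R)}) (M gamma : R).
Hypotheses (gamma_gt0 : 0 < gamma)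
  (a_bounded : forall x y : V, rnorm (a x y) <= M * rnorm x * rnorm y)
  (a_coercive : forall x : V, gamma * rnorm x ^+ 2 <= complex.Re (a x x)).

Lemma coercive_rnorm_le x (K : R) : 0 <= K ->
  rnorm (a x x) <= K * rnorm x -> gamma * rnorm x <= K.
Proof.
move=> K0 xK; have [x0|x0] := eqVneq (rnorm x) 0; first by rewrite x0 mulr0.
have xgt0 : 0 < rnorm x by rewrite lt_neqAle eq_sym x0 rnorm_ge0.
rewrite -(ler_pM2r xgt0) (le_trans _ xK)// -mulrA -expr2.
exact: le_trans (a_coercive x) (Re_le_rnorm _).
Qed.

Lemma coercive_eq0 x : a x x = 0 -> x = 0.
Proof.
move=> ax0; apply/eqP; rewrite -rnorm_eq0 eq_le rnorm_ge0 andbT.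
rewrite -(pmulr_rle0 _ gamma_gt0) coercive_rnorm_le//.
by rewrite ax0 rnorm0 mul0r.
Qed.

Lemma form_bounded_antilinear x : bounded_antilinear (a x).
Proof.
split=> [k u v|]; last by exists (M * rnorm x).
by rewrite linearDr linearZr_LR.
Qed.

(** [T] collects the data in [S] for which the equation on [S] is solvable. It is a closed subspace,
    and coercivity leaves no nonzero vector of [S] orthogonal to it. *)
Theorem lax_milgram S (f : V -> C) :
  subspace S -> closure S `<=` S -> bounded_antilinear f ->
  exists2 x, S x & forall u, S u -> a x u = f u.
Proof.
move=> subS clS /riesz_representation[g fg].
pose T := [set t | S t /\ exists2 x, S x & forall u, S u -> a x u = inner t u].
have subT : subspace T.
  split; first by split; [exact: subS.1|exists 0; [exact: subS.1|move=> u _]];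
    rewrite linear0l inner0l.
  move=> k t t' [St [x Sx xt]] [St' [x' Sx' xt']].
  split; first exact: subS.2.
  exists (k *: x + x'); first exact: subS.2.
  by move=> u Su; rewrite linearDl linearZl_LR innerDl innerZl -xt// -xt'.
(* Coercivity bounds differences of solutions by differences of data, so when data converge to [t]
   their solutions converge too, and the limit solves the equation for [t]. *)
have clT : closure T `<=` T.
  move=> t clTt; split; first by apply/clS; apply: closureS clTt => ? [].
  have /choice[y yP] (n : nat) : exists y : V * V, [/\ rnorm (t - y.1) < n.+1%:R^-1,
      S y.2 & forall u, S u -> a y.2 u = inner y.1 u].
    move/closure_rnormP : clTt => /(_ n.+1%:R^-1); rewrite invr_gt0 ltr0Sn.
    by move=> /(_ isT)[t' [_ [x' Sx' xt']] tt']; exists (t', x').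
  have ty e : 0 < e -> exists N, forall n, (N <= n)%N -> rnorm (t - (y n).1) < e.
    move=> /ex_invS_lt[N Ne]; exists N => n Nn; have [+ _ _] := yP n.
    move=> /lt_trans; apply; apply: le_lt_trans Ne.
    by rewrite lef_pV2 ?posrE// ler_nat ltnS.
  have [e e0|x xy] := @rnorm_complete _ V (fun n => (y n).2).
    have [|N Ny] := ty (gamma * e / 2); first by rewrite divr_gt0// mulr_gt0.
    exists N => m n Nm Nn; rewrite -(ltr_pM2l gamma_gt0).
    have /le_lt_trans -> // : gamma * rnorm ((y m).2 - (y n).2) <=
        rnorm ((y m).1 - (y n).1).
      apply: coercive_rnorm_le; first exact: rnorm_ge0.
      have [_ Sm ym] := yP m; have [_ Sn yn] := yP n.
      have Smn := subspaceB subS Sm Sn.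
      by rewrite linearBl ym// yn// -innerBl rnorm_inner_le.
    have := ler_rnormD ((y m).1 - t) (t - (y n).1); rewrite addrA subrK.
    move=> /le_lt_trans; apply; rewrite rnormBC [ltRHS]splitr.
    by apply: ltrD; exact: Ny.
  have Sx : S x.
    apply/clS/closure_rnormP => e /xy[N /(_ N (leqnn N)) xN].
    by exists (y N).2 => //; have [] := yP N.
  exists x => // u Su; apply/subr0_eq/eqP; rewrite -rnorm_eq0 eq_le rnorm_ge0 andbT.
  apply/ler_addgt0Pr => e e0; rewrite add0r.
  have K0 : 0 < (`|M| + 1) * (rnorm u + 1).
    by rewrite mulr_gt0// ltr_wpDl// rnorm_ge0.
  have e'0 : 0 < e / ((`|M| + 1) * (rnorm u + 1)) by rewrite divr_gt0.
  have [N1 N1x] := xy _ e'0; have [N2 N2t] := ty _ e'0; pose N := maxn N1 N2.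
  have xN := N1x N (leq_maxl _ _); have tN := N2t N (leq_maxr _ _).
  have [_ _ yN] := yP N.
  have -> : a x u - inner t u = a (x - (y N).2) u - inner (t - (y N).1) u.
    by rewrite linearBl innerBl yN// opprB addrA subrK.
  rewrite (le_trans (ler_rnormB _ _))//.
  apply: (@le_trans _ _
    (M * rnorm (x - (y N).2) * rnorm u + rnorm (t - (y N).1) * rnorm u)).
    by rewrite lerD// rnorm_inner_le.
  set q := e / _ in e'0 xN tN *; have q0 : 0 <= q by exact: ltW.
  have -> : e = (`|M| + 1) * q * (rnorm u + 1).
    by rewrite mulrAC mulrC divfK// gt_eqF.
  rewrite -mulrDl (@le_trans _ _ ((`|M| + 1) * q * rnorm u))//; last first.
    by rewrite ler_wpM2l ?lerDl// mulr_ge0// addr_ge0.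
  rewrite ler_wpM2r ?rnorm_ge0// mulrDl mul1r lerD//; last exact: ltW.
  rewrite (@le_trans _ _ (`|M| * rnorm (x - (y N).2)))//.
    by rewrite ler_wpM2r ?rnorm_ge0// ler_norm.
  by rewrite ler_wpM2l// ltW.
have [t /clT[St [x Sx xt]] gt] := closure_orthogonal_decomposition g subT.
exists x => // u Su; rewrite xt// fg; apply/eqP; rewrite -subr_eq0 -innerBl; apply/eqP.
(* [r] is the projection of the defect [t - g] onto [S], and [h'] that of the representer of [a r].
   Since [r] solves the equation for [h'], we have [h'] in [T], to which the defect is orthogonal;
   this gives [a r r = 0]. *)
have [r clr rP] := closure_orthogonal_decomposition (t - g) subS.
have Sr := clS _ clr.
have rE v : S v -> inner (t - g) v = inner r v.
  by move=> Sv; apply/subr0_eq; rewrite -innerBl rP.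
have [h ah] := riesz_representation (form_bounded_antilinear r).
have [h' clh' h'P] := closure_orthogonal_decomposition h subS.
have r0 : r = 0.
  apply: coercive_eq0; rewrite ah -(subrK h' h) innerDl h'P// add0r.
  apply: inner_eq0C; rewrite -rE; last exact: clS.
  rewrite -opprB -scaleN1r innerZl gt ?mulr0//; split; first exact: clS.
  exists r => // v Sv; apply/subr0_eq.
  by rewrite ah -innerBl h'P.
by rewrite rE// r0 inner0l.
Qed.

End Form.
End LaxMilgram.

(** * Operators into a continuously embedded Hilbert space *)

Section OperatorNorm.
Context {R : realType} {X Y : normedModType R[i]}.
Implicit Type f : X -> Y.

Lemma opnorm_le f (B : \bar R) :
  (forall x, rnorm x <= 1 -> ((rnorm (f x))%:E <= B)%E) -> (opnorm f <= B)%E.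
Proof. by move=> fB; apply: ge_ereal_sup => _ [x x1 <-]; exact: fB. Qed.

Lemma rnorm_le_opnorm f x : rnorm x <= 1 -> ((rnorm (f x))%:E <= opnorm f)%E.
Proof. by move=> x1; apply: ereal_sup_ubound; exists x. Qed.

Lemma opnorm_ge0 f : (0 <= opnorm f)%E.
Proof.
apply: (@le_trans _ _ (rnorm (f 0))%:E); first by rewrite lee_fin rnorm_ge0.
by apply: rnorm_le_opnorm; rewrite rnorm0.
Qed.

Lemma rnorm_le_opnormM f x : (forall (k : R[i]) x, f (k *: x) = k *: f x) ->
  ((rnorm (f x))%:E <= opnorm f * (rnorm x)%:E)%E.
Proof.
move=> fZ; have [->|x0] := eqVneq x 0.
  by rewrite -(scale0r 0) fZ !scale0r !rnorm0 mule0.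
have xgt0 : 0 < rnorm x by rewrite lt_neqAle eq_sym rnorm_eq0 x0 rnorm_ge0.
have : (((rnorm x)^-1 * rnorm (f x))%:E <= opnorm f)%E.
  rewrite -[X in (X * _)%:E]gtr0_norm ?invr_gt0// -rnorm_real -rnormZ -fZ.
  apply: rnorm_le_opnorm.
  by rewrite rnormZ rnorm_real gtr0_norm ?invr_gt0// mulVf// gt_eqF.
move=> /(lee_wpmul2r (_ : (0 <= (rnorm x)%:E)%E)); rewrite lee_fin ltW// => /(_ isT).
by rewrite -EFinM mulrAC mulVf ?gt_eqF// mul1r.
Qed.

Lemma opnorm_le_fin f (K : R) : 0 <= K -> (forall x, rnorm (f x) <= K * rnorm x) ->
  (opnorm f <= K%:E)%E.
Proof.
move=> K0 fK; apply: opnorm_le => x x1; rewrite lee_fin (le_trans (fK x))//.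
by rewrite ler_piMr.
Qed.

End OperatorNorm.

Section InverseOn.
Context {R : realType} {X Y : lmodType R[i]}.

Lemma inv_onK (D : set X) (f : X -> Y) x : {in D &, injective f} -> D x ->
  inv_on D f (f x) = x.
Proof. by move=> fI Dx; rewrite /inv_on pinvKV// inE. Qed.

Lemma inv_on_linear (D : set X) (f : X -> Y) : linear_on D f ->
  set_bij D [set: Y] f -> forall k x y,
  inv_on D f (k *: x + y) = k *: inv_on D f x + inv_on D f y.
Proof.
move=> [D0 fL] [_ fI fS] k x y.
have [x' Dx' <-] := fS x I; have [y' Dy' <-] := fS y I.
have [Dxy <-] := fL k _ _ Dx' Dy'.
by rewrite !inv_onK.
Qed.

End InverseOn.

Section BoundedLifting.
Context {R : realType}.

Lemma dense_rnormP (X : normedModType R[i]) (S : set X) x :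
  dense S -> closure S x.
Proof.
move=> dS B /nbhs_interior xB; rewrite setIC.
have [|y [By Sy]] := dS B^° _ (@open_interior _ _); last first.
  by exists y; split=> //; exact: interior_subset.
by exists x; exact: nbhs_singleton.
Qed.

(** A point [s] of [S] closer to [h] than [rnorm h] would give [rnorm h ^+ 2 = inner h (h - s)],
    contradicting Cauchy-Schwarz. *)
Lemma closure_inner_eq0 (H : hilbertType R) (S : set H) (h : H) :
  closure S h -> (forall s, S s -> inner h s = 0) -> h = 0.
Proof.
move=> clS hS; apply/eqP; rewrite -rnorm_eq0 eq_le rnorm_ge0 andbT leNgt.
apply/negP => h0; move/closure_rnormP : clS => /(_ (rnorm h) h0)[s Ss].
apply/negP; rewrite -leNgt -(ler_pM2l h0) (le_trans _ (rnorm_inner_le _ _))//.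
by rewrite innerBr (hS _ Ss) subr0 -expr2 -Re_innerxx Re_le_rnorm.
Qed.

(* The adjoint of the embedding has dense range, so the functionals
   [inner v \o T], for v in that range, determine the norm of [T x]; they are
   bounded because [i \o T] is. *)
Lemma bounded_lifting (X : completeNormedModType R[i]) (W H : hilbertType R)
    (i : {linear W -> H}) (T : X -> W) (K : R) :
  injective i -> continuous i ->
  (forall k x y, T (k *: x + y) = k *: T x + T y) ->
  (forall x, rnorm (i (T x)) <= K * rnorm x) ->
  exists2 L, 0 < L & forall x, rnorm (T x) <= L * rnorm x.
Proof.
move=> iI /continuous_rnorm_le[Ki Ki0 iK] TL TK.
pose G := [set v | exists h, forall w, inner h (i w) = inner v w].
have subG : subspace G.
  split; first by exists 0 => w; rewrite !inner0l.
  move=> k v v' [h hv] [h' hv']; exists (k *: h + h') => w.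
  by rewrite !innerDl !innerZl hv hv'.
(* Every functional [inner h \o i] has its representer in [G], so a vector orthogonal to [G] is
   mapped by [i] to a vector orthogonal to all of [H]. *)
have denseG w : closure G w.
  have [p clp wp] := closure_orthogonal_decomposition w subG.
  suff -> : w = p by [].
  apply/subr0_eq/iI; rewrite linear0; apply: inner_all0 => h.
  have [|v hv] := @riesz_representation _ _ (fun w => inner h (i w)).
    split=> [k x y|]; first by rewrite linearP innerDr innerZr.
    exists (rnorm h * Ki) => x; rewrite (le_trans (rnorm_inner_le _ _))//.
    by rewrite -mulrA ler_wpM2l// rnorm_ge0.
  by apply: inner_eq0C; rewrite hv; apply: inner_eq0C; apply: wp; exists h.
pose F := [set (fun x => rnorm (inner v (T x))) | v in [set v | G v /\ rnorm v <= 1]].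
have T0 : T 0 = 0 by have := TL (-1) 0 0; rewrite scaler0 addr0 scaleN1r addNr.
have [p [v [[h hv] v1] <-]|x|L L0 FL] := @seminorms_uniformly_bounded _ X F.
- split=> [x y|r x|].
  + by have := TL 1 x y; rewrite !scale1r => ->; rewrite innerDr ler_rnormD.
  + have := TL r%:C%C x 0; rewrite T0 !addr0 => ->.
    by rewrite innerZr rnormM rnorm_conj rnorm_real.
  + exists (rnorm h * K) => x; rewrite -hv (le_trans (rnorm_inner_le _ _))//.
    by rewrite -mulrA ler_wpM2l// rnorm_ge0.
- exists (rnorm (T x)) => _ [v [_ v1] <-]; rewrite (le_trans (rnorm_inner_le _ _))//.
  by rewrite ler_piMl// rnorm_ge0.
have GL v x : G v -> rnorm (inner v (T x)) <= rnorm v * (L * rnorm x).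
  move=> Gv; have [->|v0] := eqVneq v 0; first by rewrite inner0l !rnorm0 mul0r.
  have vgt0 : 0 < rnorm v by rewrite lt_neqAle eq_sym rnorm_eq0 v0 rnorm_ge0.
  rewrite -ler_pdivrMl//; apply: le_trans (FL (fun x => _) x _); last first.
    exists ((rnorm v)^-1%:C%C *: v) => //; split; first exact: subspaceZ.
    by rewrite rnormZ rnorm_real gtr0_norm ?invr_gt0// mulVf// gt_eqF.
  by rewrite /= innerZl rnormM rnorm_real gtr0_norm ?invr_gt0.
(* Taking [v] in [G] within [rnorm w / 2] of [w] gives [rnorm v <= 3 / 2 * rnorm w]. Then
   [rnorm w ^+ 2] is at most [3 / 2 * rnorm w * (L * rnorm x)] plus half of itself. *)
exists (3 * L); first by rewrite mulr_gt0.
move=> x; set w := T x; have [->|w0] := eqVneq w 0.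
  by rewrite rnorm0 !mulr_ge0 ?rnorm_ge0// ltW.
have wgt0 : 0 < rnorm w by rewrite lt_neqAle eq_sym rnorm_eq0 w0 rnorm_ge0.
have /closure_rnormP/(_ (rnorm w / 2)) := denseG w.
rewrite divr_gt0// => /(_ isT)[v Gv wv].
have Lx0 : 0 <= L * rnorm x by rewrite mulr_ge0 ?rnorm_ge0// ltW.
have vw : rnorm v <= 3 / 2 * rnorm w.
  have := ler_rnormB w (w - v); rewrite subKr; lra.
rewrite -(ler_pM2r wgt0).
have : rnorm w ^+ 2 <= rnorm (inner v w) + rnorm (inner (w - v) w).
  rewrite -Re_innerxx (le_trans (Re_le_rnorm _))//.
  by rewrite (le_trans _ (ler_rnormD _ _))// -innerDl addrC subrK.
have := le_trans (GL v x Gv) (ler_wpM2r Lx0 vw).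
have := le_trans (rnorm_inner_le (w - v) w) (ler_wpM2r (ltW wgt0) (ltW wv)).
rewrite -/w; lra.
Qed.

End BoundedLifting.

(** * The Galerkin method *)

Section OrthogonalProjection.
Context {R : realType} {H : hilbertType R}.
Variables (U : set H) (P : {linear H -> H}).
Hypotheses (subU : subspace U) (PU : orthogonal_projection_onto U P).

Lemma orthogonal_projection_in x : U (P x).
Proof. by have [[_ <- _] _] := PU; exists x. Qed.

Lemma orthogonal_projection_fix u : U u -> P u = u.
Proof. by have [[_ <- PP] _] := PU; move=> [x _ <-]; exact: PP. Qed.

Lemma orthogonal_projection_inner x u : U u -> inner (P x) u = inner x u.
Proof. by move=> Uu; apply/esym/subr0_eq; rewrite -innerBl PU.2. Qed.

Lemma orthogonal_projection_le x u : U u -> rnorm (x - P x) <= rnorm (x - u).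
Proof.
move=> Uu; have UPu : U (P x - u).
  by apply: subspaceB => //; exact: orthogonal_projection_in.
rewrite -ler_sqr ?nnegrE ?rnorm_ge0// -[x - u](subrKA (P x)).
by rewrite [leRHS]rnormD_orthogonal ?lerDl ?sqr_ge0// PU.2.
Qed.

Lemma rnorm_orthogonal_projection x : rnorm (P x) <= rnorm x.
Proof.
rewrite -ler_sqr ?nnegrE ?rnorm_ge0// -[in leRHS](subrK (P x) x).
rewrite [leRHS]rnormD_orthogonal ?lerDr ?sqr_ge0// PU.2//.
exact: orthogonal_projection_in.
Qed.

End OrthogonalProjection.

Lemma fin_dim_subspace_subspace (R : realType) (X : lmodType R[i]) (U : set X) :
  fin_dim_subspace U -> subspace U.
Proof.
move=> [d [b ->]]; split.
  by exists (fun=> 0) => //; rewrite big1// => k _; rewrite scale0r.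
move=> k _ _ [u _ <-] [v _ <-]; exists (fun j => k * u j + v j) => //.
rewrite scaler_sumr -big_split/=; apply: eq_bigr => j _.
by rewrite scalerDl scalerA.
Qed.

Lemma fin_dim_subspace_image (R : realType) (X Y : lmodType R[i])
    (f : {linear X -> Y}) (U : set X) :
  fin_dim_subspace U -> fin_dim_subspace (f @` U).
Proof.
move=> [d [b ->]]; exists d, (f \o b); apply/seteqP; split=> y /=.
  move=> [_ [u _ <-] <-]; exists u => //.
  by rewrite linear_sum; apply: eq_bigr => k _; rewrite linearZ.
move=> [u _ <-]; exists (\sum_k u k *: b k); first by exists u.
by rewrite linear_sum; apply: eq_bigr => k _; rewrite linearZ.
Qed.

(** * The operator of the form and its Galerkin approximations *)

Section FormOperator.
Context {R : realType} {H V : hilbertType R}.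
Variables (iV : {linear V -> H}) (c : R)
  (a : {bilinear V -> V -> R[i] | *%R & (Num.conj \; *%R)}) (M gamma : R).
Hypotheses (iV_dense : dense_embedding iV) (c_gt0 : 0 < c)
  (iV_bounded : forall x : V, rnorm (iV x) <= c * rnorm x)
  (gamma_gt0 : 0 < gamma) (M_gt0 : 0 < M)
  (a_bounded : forall x y : V, rnorm (a x y) <= M * rnorm x * rnorm y)
  (a_coercive : forall x : V, gamma * rnorm x ^+ 2 <= complex.Re (a x x)).

Let iV_inj : injective iV. Proof. by have [] := iV_dense. Qed.

(** By orthogonality the second argument of [a (x - x') (x - x')] may be changed by [u - x'], which
    lies in [S], and so becomes [x - u]. *)
Lemma cea_lemma S x x' u : subspace S -> S x' -> S u ->
  (forall v, S v -> a (x - x') v = 0) -> gamma * rnorm (x - x') <= M * rnorm (x - u).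
Proof.
move=> subS Sx' Su orth; apply: (coercive_rnorm_le a_coercive).
  by rewrite mulr_ge0 ?rnorm_ge0// ltW.
rewrite -[X in a _ X](subrKA u) linearDr (orth (u - x')) ?addr0; last exact: subspaceB.
by rewrite (le_trans (a_bounded _ _))// mulrAC.
Qed.

Lemma closed_preimage_projection (S : set V) (P : {linear H -> H}) :
  orthogonal_projection_onto (iV @` S) P -> closure S `<=` S.
Proof.
move=> PS x clx; suff Px : P (iV x) = iV x.
  by have := orthogonal_projection_in PS (iV x); rewrite Px => -[y Sy /iV_inj <-].
apply/esym/subr0_eq/eqP; rewrite -rnorm_eq0 eq_le rnorm_ge0 andbT.
apply/ler_addgt0Pr => e e0; rewrite add0r; have c2 : 0 < 2 * c by rewrite mulr_gt0.
move/closure_rnormP : clx => /(_ (e / (2 * c))); rewrite divr_gt0//.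
move=> /(_ isT)[y Sy]; rewrite ltr_pdivlMr// => xy.
have -> : iV x - P (iV x) = iV (x - y) - P (iV (x - y)).
  rewrite !linearB/= [P (iV y)](orthogonal_projection_fix PS); last by exists y.
  by rewrite opprK [- P _ + _]addrC subrKA.
rewrite (le_trans (ler_rnormB _ _))//.
have := rnorm_orthogonal_projection PS (iV (x - y)).
move: (iV_bounded (x - y)) xy; lra.
Qed.

Lemma form_solution S z : subspace S -> closure S `<=` S ->
  exists2 x, S x & forall u, S u -> a x u = inner z (iV u).
Proof.
move=> subS clS; apply: (lax_milgram gamma_gt0 a_bounded a_coercive) => //.
split=> [k x y|]; first by rewrite linearP innerDr innerZr.
exists (rnorm z * c) => x; rewrite (le_trans (rnorm_inner_le _ _))//.
by rewrite -mulrA ler_wpM2l// rnorm_ge0.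
Qed.

Lemma form_inj (S : set V) x y : subspace S -> S x -> S y ->
  (forall u, S u -> a x u = a y u) -> x = y.
Proof.
move=> subS Sx Sy xy; apply/subr0_eq/(coercive_eq0 gamma_gt0 a_coercive).
by rewrite linearBl xy ?subrr//; exact: subspaceB.
Qed.

Section Operator.
Variable A : H -> H.
Hypothesis hA : forall x y : V, form_domain iV a (iV x) ->
  a x y = inner (A (iV x)) (iV y).
Let D := form_domain iV a.

(** The weak equation itself bounds [a x], which places [iV x] in the domain; [A (iV x)] and [z]
    then agree against the dense range of [iV]. *)
Lemma form_domain_solution x z : (forall u, a x u = inner z (iV u)) ->
  D (iV x) /\ A (iV x) = z.
Proof.
move=> xz; have Dx : D (iV x).
  exists x => //; exists (rnorm z + 1); first by rewrite ltr_wpDl// rnorm_ge0.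
  move=> y; rewrite xz (le_trans (rnorm_inner_le _ _))//.
  by rewrite ler_wpM2r ?rnorm_ge0// lerDl.
split=> //; apply/subr0_eq/(@closure_inner_eq0 _ _ (range iV)).
  by apply: dense_rnormP; have [] := iV_dense.
by move=> _ [y _ <-]; rewrite innerBl -hA// xz subrr.
Qed.

Lemma form_operator_linear : linear_on D A.
Proof.
split=> [|k _ _ [x Dx <-] [y Dy <-]].
  rewrite -(linear0 iV); apply: (form_domain_solution (z := 0) _).1 => u.
  by rewrite linear0l inner0l.
rewrite -linearP; apply: form_domain_solution => u.
have Dix : D (iV x) by exists x.
have Diy : D (iV y) by exists y.
by rewrite linearDl linearZl_LR innerDl innerZl !hA.
Qed.

Let subT : subspace [set: V]. Proof. by []. Qed.

Lemma form_operator_bij : set_bij D [set: H] A.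
Proof.
split=> // [_ _ /set_mem[x Dx <-] /set_mem[y Dy <-] Axy|z _].
  congr (iV _); apply: (form_inj subT) => // u _.
  have Dix : D (iV x) by exists x.
  have Diy : D (iV y) by exists y.
  by rewrite !hA// Axy.
have [x _ xz] := form_solution z subT (@subsetT _ _).
by have [Dx Ax] := form_domain_solution (fun u => xz u I); exists (iV x).
Qed.

Lemma form_inverse z : exists x, [/\ inv_on D A z = iV x, D (iV x),
  forall u, a x u = inner z (iV u) & gamma * rnorm x <= c * rnorm z].
Proof.
have [x _ xz] := form_solution z subT (@subsetT _ _).
have [Dx Ax] := form_domain_solution (fun u => xz u I).
have [_ AI _] := form_operator_bij.
exists x; split=> // [|u|]; [by rewrite -{1}Ax inv_onK|exact: xz|].
apply: (coercive_rnorm_le a_coercive); first by rewrite mulr_ge0 ?rnorm_ge0// ltW.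
rewrite xz// (le_trans (rnorm_inner_le _ _))// mulrC mulrAC.
by rewrite ler_wpM2r ?rnorm_ge0.
Qed.

Lemma form_inverse_bounded z : rnorm (inv_on D A z) <= c ^+ 2 / gamma * rnorm z.
Proof.
have [x [-> _ _ xz]] := form_inverse z.
rewrite (le_trans (iV_bounded x))// expr2 -!mulrA ler_wpM2l//; first exact: ltW.
by rewrite mulrCA ler_pdivlMl.
Qed.

End Operator.

Section GalerkinOperator.
Variables (S : set V) (An : H -> H) (P : {linear H -> H}).
Hypotheses (subS : subspace S) (AnS : bounded_operator_on (iV @` S) An)
  (hAn : forall x y : V, S x -> S y -> a x y = inner (An (iV x)) (iV y))
  (PS : orthogonal_projection_onto (iV @` S) P).

Lemma galerkin_bij : set_bij (iV @` S) (iV @` S) An.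
Proof.
have [_ AnH _] := AnS; split.
- exact: AnH.
- move=> _ _ /set_mem[x Sx <-] /set_mem[y Sy <-] Axy; congr (iV _).
  by apply: (form_inj subS) => // u Su; rewrite !hAn// Axy.
- move=> _ [v Sv <-].
  have [x Sx xv] := form_solution (iV v) subS (closed_preimage_projection PS).
  have [w Sw Aw] : (iV @` S) (An (iV x)) by apply: AnH; exists x.
  exists (iV x); first by exists x.
  (* The image [w] and the target [v] both lie in [S] and have the same inner products with [S], so
     [w - v] is orthogonal to itself. *)
  rewrite -Aw; congr (iV _); apply/subr0_eq/iV_inj; rewrite linear0.
  apply: innerxx_eq0; have Swv := subspaceB subS Sw Sv.
  by rewrite {1}linearB innerBl Aw -hAn// xv// subrr.
Qed.

(** Tested against elements of [S] only, [P z] and [z] are indistinguishable, so the discrete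
    solution satisfies the weak equation of the exact one. *)
Lemma galerkin_inverse z : exists x, [/\ S x, inv_on (iV @` S) An (P z) = iV x &
  forall u, S u -> a x u = inner z (iV u)].
Proof.
have [_ AI AS] := galerkin_bij.
have [_ [x Sx <-] Ax] := AS _ (orthogonal_projection_in PS z).
exists x; split=> // [|u Su]; first by rewrite -Ax inv_onK//; exists x.
by rewrite hAn// Ax (orthogonal_projection_inner PS)//; exists u.
Qed.

End GalerkinOperator.

End FormOperator.

(** * The error estimates and uniform approximation *)

Theorem lemma5p1 (R : realType) (H V W : hilbertType R)
  (iV : {linear V -> H}) (hiV : dense_embedding iV)
  (c : R) (hc : 0 < c) (hcV : forall x : V, rnorm (iV x) <= c * rnorm x)
  (a : {bilinear V -> V -> R[i] | *%R & (Num.conj \; *%R)}) (M gamma : R) (hM : 0 < M) (hgamma : 0 < gamma)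
  (ha_bounded : forall x y : V, rnorm (a x y) <= M * rnorm x * rnorm y)
  (ha_coercive : forall x : V, gamma * rnorm x ^+ 2 <= complex.Re (a x x))
  (A : H -> H)
  (hA : forall x y : V, form_domain iV a (iV x) ->
          a x y = inner (A (iV x)) (iV y))
  (U : nat -> set V) (hU : forall n, fin_dim_subspace (U n))
  (hU_incr : forall n, U n `<=` U n.+1)
  (An : nat -> H -> H)
  (hAn_op : forall n, bounded_operator_on (iV @` U n) (An n))
  (hAn : forall n (x y : V), U n x -> U n y ->
           a x y = inner (An n (iV x)) (iV y))
  (P : nat -> {linear H -> H})
  (hP : forall n, orthogonal_projection_onto (iV @` U n) (P n))
  (iW : {linear W -> H}) (hiW : dense_embedding iW)
  (hDW : form_domain iV a `<=` range iW)
  (jWV : {linear W -> V}) (hjWV : forall w : W, iV (jWV w) = iW w)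
  (Q : nat -> {linear W -> V}) (hQ_cont : forall n, continuous (Q n))
  (hQ_range : forall n, range (Q n) `<=` U n)
  (hQ_lim : opnorm (fun w : W => jWV w - Q n w) @[n --> \oo] --> 0%E) :
  let D := form_domain iV a in
  let Ainv := inv_on D A in
  (* the inverse of A as an operator from H to W *)
  let AinvW := inv_on [set: W] iW \o Ainv in
  [/\ forall n, (opnorm (fun w : W => iW w - P n (iW w))%R <=
                 c%:E * opnorm (fun w : W => jWV w - Q n w)%R)%E,
      forall n, (opnorm (fun z : H =>
                   Ainv z - inv_on (iV @` U n) (An n) (P n z))%R <=
                 (c * M / gamma)%:E * opnorm AinvW *
                 opnorm (fun w : W => jWV w - Q n w)%R)%E &
      approximates_uniformly iW D A (fun n => iV @` U n) P An].
Proof.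
move=> D Ainv AinvW.
have subU n : subspace (U n) by exact: fin_dim_subspace_subspace.
have subiU n : subspace (iV @` U n).
  exact/fin_dim_subspace_subspace/fin_dim_subspace_image.
have [iW_inj iW_cont _] := hiW.
have iWK w : inv_on [set: W] iW (iW w) = w.
  by rewrite inv_onK// => ? ? _ _; exact: iW_inj.
have invA := form_inverse hiV hc hcV hgamma ha_bounded ha_coercive hA.
have Abij := form_operator_bij hiV hcV hgamma ha_bounded ha_coercive hA.
have Abound := form_inverse_bounded hiV hc hcV hgamma ha_bounded ha_coercive hA.
have Alin := form_operator_linear hiV hA.
have AinvWP z : iW (AinvW z) = Ainv z.
  have [x [Ez Dx _ _]] := invA z.
  have [w _ wE] := hDW _ Dx; rewrite -/D -/Ainv in Ez.
  by rewrite /AinvW/= Ez -wE iWK.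
(* Without a finite norm here, the factor in the second estimate could be infinite and the bound
   would not tend to 0. *)
have AinvW_fin : opnorm AinvW \is a fin_num.
  have [k x y|x|L L0 LW] := bounded_lifting iW_inj iW_cont (T := AinvW)
      (K := c ^+ 2 / gamma).
  - by apply: iW_inj; rewrite linearP !AinvWP /Ainv inv_on_linear.
  - by rewrite AinvWP; exact: Abound.
  rewrite ge0_fin_numE ?opnorm_ge0//.
  by rewrite (le_lt_trans (opnorm_le_fin _ LW)) ?ltry// ltW.
have est1 n : (opnorm (fun w : W => iW w - P n (iW w))%R <=
    c%:E * opnorm (fun w : W => jWV w - Q n w)%R)%E.
  apply: opnorm_le => w w1.
  have Qw : (iV @` U n) (iV (Q n w)) by exists (Q n w) => //; apply: hQ_range; exists w.
  apply: (@le_trans _ _ (c * rnorm (jWV w - Q n w))%:E).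
    rewrite lee_fin (le_trans (orthogonal_projection_le (subiU n) (hP n) _ Qw))//.
    by rewrite -hjWV -linearB.
  rewrite EFinM lee_wpmul2l//; first by rewrite lee_fin ltW.
  exact: rnorm_le_opnorm.
have est2 n : (opnorm (fun z : H => Ainv z - inv_on (iV @` U n) (An n) (P n z))%R <=
    (c * M / gamma)%:E * opnorm AinvW *
    opnorm (fun w : W => jWV w - Q n w)%R)%E.
  apply: opnorm_le => z z1; set w := AinvW z.
  have [x [Ez Dx xz _]] := invA z; rewrite -/D -/Ainv in Ez.
  have [x' [Ux' -> x'z]] := galerkin_inverse hiV hc hcV hgamma ha_bounded ha_coercive
    (subU n) (hAn_op n) (hAn n) (hP n) z.
  have xE : x = jWV w.
    by have [iV_inj _ _] := hiV; apply: iV_inj; rewrite hjWV AinvWP Ez.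
  have Qw : U n (Q n w) by apply: hQ_range; exists w.
  have orth v : U n v -> a (x - x') v = 0.
    by move=> Uv; rewrite linearBl xz x'z// subrr.
  have xx' := cea_lemma hM ha_bounded ha_coercive (subU n) Ux' Qw orth.
  apply: (@le_trans _ _ (c * M / gamma * rnorm (x - Q n w))%:E).
    rewrite Ez -linearB lee_fin (le_trans (hcV _))// -!mulrA ler_wpM2l//.
      exact: ltW.
    by rewrite mulrCA ler_pdivlMl.
  have K0 : 0 <= c * M / gamma by rewrite ltW// divr_gt0// mulr_gt0.
  rewrite EFinM -muleA lee_wpmul2l ?lee_fin// muleC xE.
  (* [w] may lie outside the unit ball of [W], so homogeneity is used to bring out the factor
     [rnorm w], itself at most [opnorm AinvW]. *)
  have fZ (k : R[i]) v : jWV (k *: v) - Q n (k *: v) = k *: (jWV v - Q n v).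
    by rewrite scalerBr !linearZ_LR.
  apply: (le_trans (rnorm_le_opnormM w fZ)).
  by rewrite lee_wpmul2l ?opnorm_ge0// rnorm_le_opnorm.
have bound0 (k : \bar R) (u : nat -> \bar R) : k \is a fin_num ->
    (forall n, 0 <= u n)%E ->
    (forall n, u n <= k * opnorm (fun w : W => jWV w - Q n w)%R)%E ->
    u n @[n --> \oo] --> 0%E.
  move=> kfin u0 uk; apply: (squeeze_cvge _ (cvg_cst 0%E)); last first.
    by have := cvgeZl kfin hQ_lim; rewrite mule0; exact.
  by apply: nearW => n; rewrite /= u0 uk.
split=> //; split.
- split=> //; have K0 : 0 <= c ^+ 2 / gamma by rewrite divr_ge0 ?sqr_ge0// ltW.
  by rewrite (le_lt_trans (opnorm_le_fin K0 Abound))// ltry.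
- by move=> n; exact: fin_dim_subspace_image.
- split; first by move=> n; have [] := hP n.
    (* Orthogonal projections are contractions, so 1 bounds all the norms. *)
    apply: (@le_lt_trans _ _ 1%E); last exact: ltry.
    apply: ge_ereal_sup => _ [n _ <-]; apply: opnorm_le_fin => // x.
    by rewrite mul1r (rnorm_orthogonal_projection (hP n)).
  by apply: (bound0 c%:E) => // n; exact: opnorm_ge0.
- split=> [n|].
    split; first exact: hAn_op.
    exact: (galerkin_bij hiV hc hcV hgamma ha_bounded ha_coercive
      (subU n) (hAn_op n) (hAn n) (hP n)).
  apply: (bound0 ((c * M / gamma)%:E * opnorm AinvW)%E) => //; first by rewrite fin_numM.
  by move=> n; exact: opnorm_ge0.
Qed.
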